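(* Consider a single-commodity network congestion game with unknown demands and affine costs. If $|\Theta|=2$, i.e., $\Theta=\{\theta_1,\theta_2\}$ with $0<d_{\theta_1}<d_{\theta_2}=1$, then $C(\mu)$ is non-decreasing in $\mu_{\theta_2}$.
   Context: Network congestion game with unknown demand (single commodity). $G=(V,E)$ is a directed graph with source $s\in V$ and destination $t\in V$. Every edge $e$ has an affine cost function $c_e(x)=a_e x+b_e$ with $a_e\in\mathbb{R}_{>0}$, $b_e\in\mathbb{R}_{\ge 0}$. $\Theta$ is a finite set of states of nature; state $\theta$ is associated with a demand $d_\theta$. $\Delta(\Theta)$ is the set of probability distributions on $\Theta$ (for two states, $\mu\in\Delta(\Theta)$ is determined by $\mu_{\theta_2}\in[0,1]$, with $\mu_{\theta_1}=1-\mu_{\theta_2}$). $\mathcal{P}$ is the set of directed $s$-$t$-paths. A path flow is a vector $x=(x_P)_{P\in\mathcal{P}}$ with $x_P\ge 0$ and $\sum_{P}x_P=1$. The load of $x$ on $e$ is $x_e=\sum_{P\in\mathcal{P}:e\in P}x_P$. For $\mu\in\Delta(\Theta)$ the expected cost of $e$ is $c_e(x_e\mid\mu)=\sum_{\theta\in\Theta}\mu_\theta d_\theta c_e(d_\theta x_e)$ and that of a path is $c_P(x\mid\mu)=\sum_{e\in P}c_e(x_e\mid\mu)$. A path flow $x$ is a Wardrop equilibrium for $\mu$ if $c_P(x\mid\mu)\le c_Q(x\mid\mu)$ for all $P,Q\in\mathcal{P}$ with $x_P>0$. The Wardrop equilibrium $x^*(\mu)$ is unique (in terms of edge loads), and $C(\mu)=\sum_{e\in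 E}x^*_e(\mu)\,c_e(x^*_e(\mu)\mid\mu)$ is its total cost. *)

(* Defs.v *)
From HB Require Import structures.
From mathcomp Require Import all_boot all_order all_algebra.
From mathcomp Require Import boolp classical_sets reals.

Set Implicit Arguments.
Unset Strict Implicit.
Unset Printing Implicit Defensive.

Import Order.TTheory GRing.Theory Num.Theory.
Local Open Scope ring_scope.

(* Edges are a type of their own, so parallel edges and loops are allowed; a
   graph with edge set contained in V x V is the case where [tail] and [head]
   are the two projections. *)
Record congestion_game (R : realType) (Theta : finType) := CongestionGame {
  vertex : finType;
  edge : finType;
  tail : edge -> vertex;
  head : edge -> vertex;
  source : vertex;
  destination : vertex;
  slope : edge -> R;
  intercept : edge -> R;
  slope_gt0 : forall e, 0 < slope e;
  intercept_ge0 : forall e, 0 <= intercept e;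
  demand : Theta -> R
}.

Definition is_distribution (R : realType) (Theta : finType)
    (mu : Theta -> R) : Prop :=
  (forall theta, 0 <= mu theta) /\ \sum_theta mu theta = 1.

Section CongestionGame.
Variables (R : realType) (Theta : finType) (G : congestion_game R Theta).

Implicit Types (mu : Theta -> R) (e : edge G).

Fixpoint is_walk (u v : vertex G) (p : seq (edge G)) : bool :=
  if p is e :: p' then (tail e == u) && is_walk (head e) v p' else u == v.

(* [u :: map head p] lists the vertices visited, so a path has no repeated
   vertex. *)
Definition is_path (u v : vertex G) (p : seq (edge G)) : bool :=
  is_walk u v p && uniq (u :: map (@head _ _ G) p).

Lemma size_is_path u v (p : seq (edge G)) :
  is_path u v p -> (size p <= #|edge G|)%N.
Proof.
case/andP=> _ /= /andP[_ /map_uniq p_uniq].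
by rewrite -(card_uniqP p_uniq) max_card.
Qed.

(* The length bound, which only serves to make the type finite, excludes no
   path, by [size_is_path]. *)
Definition st_path : Type :=
  {p : #|edge G|.-bseq (edge G) | is_path (source G) (destination G) p}.
HB.instance Definition _ := Finite.on st_path.

Definition on_path (P : st_path) : {pred edge G} := mem (bseqval (val P)).


Definition is_path_flow (x : {ffun st_path -> R}) : Prop :=
  (forall P, 0 <= x P) /\ \sum_P x P = 1.

Definition load (x : {ffun st_path -> R}) e : R :=
  \sum_(P | e \in on_path P) x P.

Definition edge_cost e (z : R) : R := slope e * z + intercept e.

Definition expected_edge_cost mu e (z : R) : R :=
  \sum_theta mu theta * demand G theta * edge_cost e (demand G theta * z).

Definition expected_path_cost mu (x : {ffun st_path -> R}) (P : st_path) : R :=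
  \sum_(e in on_path P) expected_edge_cost mu e (load x e).

Definition is_wardrop mu (x : {ffun st_path -> R}) : Prop :=
  is_path_flow x /\
  forall P Q, 0 < x P -> expected_path_cost mu x P <= expected_path_cost mu x Q.

(* Only the edge loads of an equilibrium are unique, so one equilibrium path
   flow is selected; the default is used only if there is none. *)
Definition wardrop_flow mu : {ffun st_path -> R} :=
  xget [ffun=> 0] (is_wardrop mu).

Definition total_cost mu : R :=
  \sum_e load (wardrop_flow mu) e
         * expected_edge_cost mu e (load (wardrop_flow mu) e).

End CongestionGame.

(* Main.v *)
(* Write A and B for the second and the first moment of the demand, so that the
   expected cost of an edge is A a_e z + B b_e.  Up to the factor B, an
   equilibrium is one of the deterministic game with costs a_e z + b_e and demand
   A / B.  Moving mass to the larger demand theta2 increases both B and A / B.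
   Adding the variational inequalities of two equilibria with different demands
   shows that the equilibrium path cost increases with the demand, hence so does
   C = B * (path cost).  Equilibria exist as minimisers of a quadratic potential
   on the simplex; without any s-t-path both costs are 0. *)
Require Import Defs.
From HB Require Import structures.
From mathcomp Require Import all_boot all_order all_algebra ring lra.
From mathcomp Require Import boolp classical_sets functions reals.
From mathcomp Require Import topology normedtype derive.

Import Order.TTheory GRing.Theory Num.Theory.
Import numFieldTopology.Exports numFieldNormedType.Exports.
Local Open Scope ring_scope.

(** * Continuity and compactness on the simplex *)

Lemma continuous_sum (R : realType) (T : topologicalType) (I : finType)
    (P : pred I) (f : I -> T -> R) :
  (forall i, continuous (f i)) ->
  continuous (fun x => \sum_(i | P i) f i x).
Proof.
move=> f_cont; rewrite -[X in continuous X](fct_sumE _ P f).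
apply: (big_ind (fun g : T -> R => continuous g)) => [x|g h g_cont h_cont x|i _].
- exact: cvg_cst.
- by apply: cvgD; [exact: g_cont | exact: h_cont].
- exact: f_cont.
Qed.

Lemma continuous_quadratic (R : realType) (T : topologicalType)
    (f : T -> R) (a b : R) :
  continuous f -> continuous (fun x => a * f x ^+ 2 + b * f x).
Proof.
move=> f_cont x; apply: cvgD; apply: cvgM; try exact: cvg_cst.
  by rewrite expr2; apply: cvgM; exact: f_cont.
exact: f_cont.
Qed.

Definition simplex (R : realType) (n : nat) : set 'rV[R]_n :=
  [set v | (forall i, 0 <= v ord0 i) /\ \sum_i v ord0 i = 1]%classic.

Lemma compact_simplex (R : realType) (n : nat) : compact (@simplex R n).
Proof.
have sum_cont : continuous (fun v : 'rV[R]_n => \sum_i v ord0 i).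
  by apply: continuous_sum => i; exact: coord_continuous.
(* A closed slice of the cube [[0, 1]^n]; the upper bounds hold because the other coordinates are
   nonnegative. *)
rewrite (_ : simplex R n = [set v : 'rV[R]_n | forall i, `[0, 1]%classic (v ord0 i)]
    `&` (fun v : 'rV[R]_n => (\sum_i v ord0 i : R)) @^-1` [set x | x = 1])%classic.
  apply: compact_closedI; last first.
    by apply: preimage_closed => [v _|]; [exact: sum_cont | exact: closed_eq].
  apply: (@rV_compact R n (fun=> `[0, 1]%classic)) => _.
  exact: segment_compact.
apply/seteqP; split=> v [] /= v_ge0 v1; split=> // i; last first.
  by have := v_ge0 i; rewrite in_itv /= => /andP[].
rewrite in_itv /= v_ge0 -v1 (bigD1 i) //= lerDl.
by apply: sumr_ge0.
Qed.

Section Equilibrium.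
Variables (R : realType) (Theta : finType) (G : congestion_game R Theta).

Implicit Types (mu : Theta -> R) (e : edge G) (P Q : st_path G).
Implicit Types (x y z w : {ffun st_path G -> R}).

(** * Demand moments, edge loads and the potential *)

Definition mean_demand mu : R := \sum_theta mu theta * demand G theta.

Definition demand_moment2 mu : R := \sum_theta mu theta * demand G theta ^+ 2.

Lemma demand_moment2_ge0 mu :
  (forall theta, 0 <= mu theta) -> 0 <= demand_moment2 mu.
Proof.
by move=> mu_ge0; apply: sumr_ge0 => theta _; rewrite mulr_ge0 ?sqr_ge0.
Qed.

Lemma expected_edge_costE mu e (z : R) :
  expected_edge_cost mu e z =
  demand_moment2 mu * slope e * z + mean_demand mu * intercept e.
Proof.
rewrite /expected_edge_cost /demand_moment2 /mean_demand !mulr_suml -big_split.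
by apply: eq_bigr => theta _; rewrite /edge_cost /=; ring.
Qed.

Lemma load_ge0 x e : (forall P, 0 <= x P) -> 0 <= load x e.
Proof. by move=> x_ge0; apply: sumr_ge0. Qed.

Lemma load_sum x (c : edge G -> R) :
  \sum_e load x e * c e = \sum_P x P * \sum_(e in on_path P) c e.
Proof.
under eq_bigr do rewrite mulr_suml.
rewrite (exchange_big_dep xpredT) //=.
by apply: eq_bigr => P _; rewrite mulr_sumr.
Qed.

Lemma load_shift x w (h : R) e :
  load [ffun P => x P + h * w P] e = load x e + h * load w e.
Proof.
rewrite /load mulr_sumr -big_split /=.
by apply: eq_bigr => P _; rewrite ffunE.
Qed.

(** The Beckmann potential: each edge contributes the integral of its expected cost from 0 to its
    load. *)
Definition potential mu x : R :=
  \sum_e (demand_moment2 mu * slope e / 2 * load x e ^+ 2 +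
          mean_demand mu * intercept e * load x e).

Definition potential_curvature mu w : R :=
  \sum_e demand_moment2 mu * slope e / 2 * load w e ^+ 2.

(** An exact second-order Taylor expansion: the derivative of the potential in the coordinate of a
    path is the expected cost of that path. *)
Lemma potential_shift mu x w (h : R) :
  potential mu [ffun P => x P + h * w P] = potential mu x +
    h * (\sum_P w P * expected_path_cost mu x P) +
    h ^+ 2 * potential_curvature mu w.
Proof.
rewrite -(load_sum w (fun e => expected_edge_cost mu e (load x e))).
rewrite !mulr_sumr -!big_split /=; apply: eq_bigr => e _.
by rewrite load_shift expected_edge_costE; field.
Qed.

Lemma sum_transfer P Q (f : st_path G -> R) :
  \sum_S ((S == Q)%:R - (S == P)%:R) * f S = f Q - f P.
Proof.
have sum1 T : \sum_S (S == T)%:R * f S = f T.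
  rewrite (bigD1 T) //= eqxx mul1r big1 ?addr0 // => S /negPf ->.
  by rewrite mul0r.
by under eq_bigr do rewrite mulrBl; rewrite sumrB !sum1.
Qed.

Lemma path_flow_transfer x P Q (h : R) : is_path_flow x -> 0 <= h <= x P ->
  is_path_flow [ffun S => x S + h * ((S == Q)%:R - (S == P)%:R)].
Proof.
move=> [x_ge0 x1] /andP[h_ge0 hP]; split=> [S|].
  rewrite ffunE; have := x_ge0 S; case: (S =P P) => [->|_];
  by case: eqP => _ /=; lra.
under eq_bigr do rewrite ffunE.
rewrite big_split /= x1 -mulr_sumr.
have := sum_transfer P Q (fun=> 1); under eq_bigr do rewrite mulr1.
by move=> ->; rewrite subrr mulr0 addr0.
Qed.

(** First-order optimality: if [Q] were cheaper than a used path [P], moving a little flow from [P]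
    to [Q] would lower the potential. *)
Lemma potential_min_wardrop mu x : (forall theta, 0 <= mu theta) ->
  is_path_flow x ->
  (forall y, is_path_flow y -> potential mu x <= potential mu y) ->
  is_wardrop mu x.
Proof.
move=> mu_ge0 x_flow x_min; split=> // P Q xP_gt0.
pose w : {ffun st_path G -> R} := [ffun S => (S == Q)%:R - (S == P)%:R].
pose D := expected_path_cost mu x Q - expected_path_cost mu x P.
pose K := potential_curvature mu w.
have K_ge0 : 0 <= K.
  apply: sumr_ge0 => e _; rewrite mulr_ge0 ?sqr_ge0 // divr_ge0 //.
  by rewrite mulr_ge0 ?(ltW (slope_gt0 _)) // demand_moment2_ge0.
have D_eq : \sum_S w S * expected_path_cost mu x S = D.
  by under eq_bigr do rewrite ffunE; rewrite sum_transfer.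
have shift_ge0 (h : R) : 0 <= h <= x P -> 0 <= h * D + h ^+ 2 * K.
  move=> h_bnd; have /x_min := path_flow_transfer x P Q h x_flow h_bnd.
  rewrite (_ : [ffun S => _] = [ffun S => x S + h * w S]); last first.
    by apply/ffunP => S; rewrite !ffunE.
  by rewrite potential_shift D_eq -addrA lerDl.
rewrite -subr_ge0 -/D leNgt; apply/negP => D_lt0.
have K1_gt0 : 0 < K + 1 by lra.
(* The first bound keeps the flow on [P] nonnegative; the second gives [D + h * K <= - h < 0].
   Dividing by [K + 1] rather than [K] covers [K = 0]. *)
pose h := Num.min (x P) (- D / (K + 1)).
have h_gt0 : 0 < h by rewrite lt_min xP_gt0 divr_gt0 // oppr_gt0.
have := shift_ge0 h; rewrite (ltW h_gt0) ge_min lexx => /(_ isT).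
have hK : h * (K + 1) <= - D by rewrite -ler_pdivlMr // ge_min lexx orbT.
rewrite expr2 -mulrA -mulrDr pmulr_rge0 //; lra.
Qed.

Lemma wardrop_exists mu : (forall theta, 0 <= mu theta) ->
  (exists x : {ffun st_path G -> R}, is_path_flow x) ->
  exists x : {ffun st_path G -> R}, is_wardrop mu x.
Proof.
move=> mu_ge0 [x0 x0_flow].
(* Path flows are identified with row vectors, on which the topology and the compact simplex
   live. *)
pose flow_of (v : 'rV[R]_#|{: st_path G}|) : {ffun st_path G -> R} :=
  [ffun P => v ord0 (enum_rank P)].
pose row_of x : 'rV[R]_#|{: st_path G}| := \row_i x (enum_val i).
have row_ofK x : flow_of (row_of x) = x.
  by apply/ffunP => P; rewrite !ffunE mxE enum_rankK.
have flowP v : is_path_flow (flow_of v) <-> simplex R _ v.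
  have sumE : \sum_P flow_of v P = \sum_i v ord0 i.
    rewrite [RHS](reindex (enum_rank (T := st_path G))) /=.
      by apply: eq_bigr => P _; rewrite ffunE.
    exact/onW_bij/enum_rank_bij.
  rewrite /is_path_flow /simplex /= sumE.
  split=> -[v_ge0 v1]; split=> // i; last by rewrite ffunE.
  by have := v_ge0 (enum_val i); rewrite ffunE enum_valK.
have load_cont e : continuous (fun v => load (flow_of v) e).
  rewrite (_ : (fun v => _) =
      fun v : 'rV[R]_#|{: st_path G}| =>
        \sum_(P | e \in on_path P) v ord0 (enum_rank P)).
    by apply: continuous_sum => P; exact: coord_continuous.
  by apply/funext => v; apply: eq_bigr => P _; rewrite ffunE.
have pot_cont : continuous (fun v => potential mu (flow_of v)).
  by apply: continuous_sum => e; exact: continuous_quadratic.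
have [v] : exists2 v, v \in simplex R _ & forall u, u \in simplex R _ ->
    potential mu (flow_of v) <= potential mu (flow_of u).
  apply: compact_EVT_min; last exact: continuous_subspaceT.
    by exists (row_of x0); apply/flowP; rewrite row_ofK.
  exact: compact_simplex.
rewrite inE => /flowP v_flow v_min; exists (flow_of v).
apply: potential_min_wardrop => // y y_flow.
by rewrite -(row_ofK y); apply: v_min; rewrite inE; apply/flowP; rewrite row_ofK.
Qed.

(** * Comparison of two equilibria *)

Lemma wardrop_variational mu x z : is_wardrop mu x -> is_path_flow z ->
  \sum_e load x e * expected_edge_cost mu e (load x e) <=
  \sum_e load z e * expected_edge_cost mu e (load x e).
Proof.
move=> [[x_ge0 x1] x_eq] [z_ge0 z1].
rewrite !(load_sum _ (fun e => expected_edge_cost mu e (load x e))).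
(* Multiplying each side by the total mass 1 of the other flow turns both into double sums with
   weights [x P * z Q]. They compare termwise, as a path with [x P > 0] is a cheapest one. *)
rewrite -[leLHS]mulr1 -[leRHS]mul1r -[X in _ * X <= _]z1 -[X in _ <= X * _]x1.
rewrite !big_distrlr /=; apply: ler_sum => P _; apply: ler_sum => Q _.
rewrite mulrAC [leRHS]mulrA; have [xP|] := ltP 0 (x P).
  by rewrite ler_wpM2l ?mulr_ge0 //; exact: x_eq.
move=> xP_le0; have -> : x P = 0 by apply: le_anti; rewrite xP_le0 x_ge0.
by rewrite !mul0r.
Qed.

(* The strict inequality compares the deterministic demands
   [demand_moment2 / mean_demand], with denominators cleared. *)
Lemma wardrop_cost_le mu nu x y : is_wardrop mu x -> is_wardrop nu y ->
  0 <= demand_moment2 mu -> 0 < mean_demand mu ->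
  mean_demand mu <= mean_demand nu ->
  demand_moment2 mu * mean_demand nu < demand_moment2 nu * mean_demand mu ->
  0 <= \sum_e load y e * expected_edge_cost nu e (load y e) ->
  \sum_e load x e * expected_edge_cost mu e (load x e) <=
  \sum_e load y e * expected_edge_cost nu e (load y e).
Proof.
move=> x_eq y_eq; have [[x_flow _] [y_flow _]] := (x_eq, y_eq).
move: (wardrop_variational _ _ _ x_eq y_flow)
  (wardrop_variational _ _ _ y_eq x_flow).
have cost_split rho z w :
    \sum_e load z e * expected_edge_cost rho e (load w e) =
    demand_moment2 rho * (\sum_e slope e * load z e * load w e) +
    mean_demand rho * (\sum_e intercept e * load z e).
  rewrite !mulr_sumr -big_split /=; apply: eq_bigr => e _.
  by rewrite expected_edge_costE; ring.
have square_ge0 a b : 0 <= a ^+ 2 * (\sum_e slope e * load x e * load x e)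
    - 2 * a * b * (\sum_e slope e * load x e * load y e)
    + b ^+ 2 * (\sum_e slope e * load y e * load y e).
  rewrite !mulr_sumr -sumrB -big_split /=; apply: sumr_ge0 => e _.
  rewrite (_ : _ + _ = slope e * (a * load x e - b * load y e) ^+ 2); last by ring.
  by rewrite mulr_ge0 ?sqr_ge0 // ltW // slope_gt0.
rewrite !cost_split.
have -> : \sum_e slope e * load y e * load x e =
          \sum_e slope e * load x e * load y e.
  by apply: eq_bigr => e _; ring.
move: (demand_moment2 mu) (demand_moment2 nu) (mean_demand mu) (mean_demand nu)
  (\sum_e slope e * load x e * load x e) (\sum_e slope e * load x e * load y e)
  (\sum_e slope e * load y e * load y e) (\sum_e intercept e * load x e)
  (\sum_e intercept e * load y e) square_ge0 => A A' B B' X M Y u v.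
(* With these weights the square bounds the cross term [2 * A * A' * B * B' * M] by multiples of [X]
   and [Y] that recombine with [u] and [v] into [A * B' ^+ 2 * C + A' * B ^+ 2 * C']. *)
move=> /(_ (A * B') (A' * B)) sq_ge0 x_le y_le A_ge0 B_gt0 leB lt_scaling.
have B'_gt0 : 0 < B' := lt_le_trans B_gt0 leB.
have AB'_ge0 : 0 <= A * B' by rewrite mulr_ge0 // ltW.
have A'B_ge0 : 0 <= A' * B := le_trans AB'_ge0 (ltW lt_scaling).
set C' := A' * Y + B' * v in y_le * => C'_ge0; set C := A * X + B * u in x_le *.
(* The two multipliers give [M] the same coefficient in both variational inequalities, so their sum
   and the square eliminate it. *)
have scaled_le : (A' * B - A * B') * (B' * C - B * C') <= 0.
  have := lerD (ler_wpM2l (mulr_ge0 (ltW B'_gt0) A'B_ge0) x_le)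
               (ler_wpM2l (mulr_ge0 (ltW B_gt0) AB'_ge0) y_le).
  rewrite /C /C'; lra.
(* Hence [C / B <= C' / B'], the comparison of path costs; [C' >= 0] and [B <= B'] then give
   [C <= C']. *)
move: scaled_le; rewrite pmulr_rle0 ?subr_gt0 // subr_le0 => B'C_le.
by rewrite -(ler_pM2l B'_gt0) (le_trans B'C_le) // ler_wpM2r.
Qed.

End Equilibrium.

(** * The case of two states *)

Lemma setT_pair (T : finType) (t1 t2 : T) :
  #|T| = 2%N -> t1 != t2 -> [set t1; t2] = [set: T].
Proof.
move=> card_T neq; apply/eqP.
by rewrite eqEcard finset.subsetT cardsT card_T cards2 neq.
Qed.

Theorem corollary3 (R : realType) (Theta : finType)
    (G : congestion_game R Theta) (theta1 theta2 : Theta)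
    (card_Theta : #|Theta| = 2%N)
    (demand1_gt0 : 0 < demand G theta1)
    (demand_lt : demand G theta1 < demand G theta2)
    (demand2 : demand G theta2 = 1)
    (mu nu : Theta -> R)
    (mu_distr : is_distribution mu) (nu_distr : is_distribution nu)
    (le_mu_nu : mu theta2 <= nu theta2) :
  total_cost G mu <= total_cost G nu.
Proof.
have neq12 : theta1 != theta2.
  by apply: contraTneq demand_lt => ->; rewrite ltxx.
have sumE (f : Theta -> R) : \sum_theta f theta = f theta1 + f theta2.
  rewrite (eq_bigl (mem [set theta1; theta2])) => [|theta]; last first.
    by rewrite (setT_pair _ _ _ card_Theta neq12) !inE.
  by rewrite big_setU1 ?big_set1 // inE.
have [mu_ge0 mu_sum] := mu_distr; have [nu_ge0 nu_sum] := nu_distr.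
rewrite sumE in mu_sum; rewrite sumE in nu_sum.
have [flow_ex|no_flow] :=
  pselect (exists x : {ffun st_path G -> R}, is_path_flow x);
    last first.
  (* Without path flows there is no equilibrium, so [xget] returns its default, the zero flow. *)
  have no_wardrop rho : wardrop_flow G rho = [ffun=> 0].
    by apply: xgetPN => x [x_flow _]; apply: no_flow; exists x.
  rewrite /total_cost !no_wardrop !big1 // => e _;
    by rewrite /load big1 ?mul0r // => P _; rewrite ffunE.
have wardrop_flowP rho : (forall theta, 0 <= rho theta) ->
    is_wardrop rho (wardrop_flow G rho).
  by move=> rho_ge0; apply: xgetPex; exact: wardrop_exists.
(* Equality is split off because [wardrop_cost_le] asks for a strict inequality; two distributions
   that agree at [theta2] coincide. *)
move: le_mu_nu; rewrite le_eqVlt => /orP[/eqP eq_mu_nu|lt_mu_nu].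
  suff -> : mu = nu by [].
  apply/funext => theta; have := finset.in_setT theta.
  by rewrite -(setT_pair _ _ _ card_Theta neq12) !inE => /orP[] /eqP ->; lra.
have [mu1 nu1] : mu theta1 = 1 - mu theta2 /\ nu theta1 = 1 - nu theta2 by lra.
have [mu1_ge0 mu2_ge0] := (mu_ge0 theta1, mu_ge0 theta2).
have [nu1_ge0 nu2_ge0] := (nu_ge0 theta1, nu_ge0 theta2).
apply: wardrop_cost_le; try exact: wardrop_flowP.
- exact: demand_moment2_ge0.
- by rewrite /mean_demand sumE demand2 mu1; nra.
- by rewrite /mean_demand !sumE demand2 mu1 nu1; nra.
- rewrite /mean_demand /demand_moment2 !sumE demand2 mu1 nu1 expr1n.
  rewrite -subr_gt0.
  set d := demand G theta1; set p := mu theta2; set q := nu theta2.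
  (* The terms in [p * q] cancel; the remaining factors are positive since [p < q] and
     [0 < d < 1]. *)
  rewrite (_ : _ - _ = (q - p) * (d * (1 - d))); last by ring.
  by rewrite !mulr_gt0 ?subr_gt0 // -demand2.
- have [[nu_flow_ge0 _] _] := wardrop_flowP nu nu_ge0.
  apply: sumr_ge0 => e _; rewrite mulr_ge0 ?load_ge0 //.
  have demand_cost_ge0 theta : 0 < demand G theta ->
      0 <= nu theta * demand G theta *
        edge_cost e (demand G theta * load (wardrop_flow G nu) e).
    move=> /ltW demand_ge0; rewrite !mulr_ge0 // addr_ge0 ?intercept_ge0 //.
    by rewrite !mulr_ge0 ?load_ge0 // ltW // slope_gt0.
  by rewrite /expected_edge_cost sumE addr_ge0 ?demand_cost_ge0 // demand2 ltr01.
Qed.
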